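(* Suppose that the partially ordered set $I$ has no maximal element. If every morphism in $\mathscr{C}$ is a monomorphism, then $\mathscr{C}\text{-fdmod}\subseteq\operatorname{Ker}(\nu)$.
   Context: Let $\Bbbk$ be a field. An EI-category is a small category in which every endomorphism is an isomorphism. $\mathscr{C}$ is a skeletal EI-category with object set $I$; $\mathscr{C}(i,j)$ is the set of morphisms from $i$ to $j$, and $I$ is partially ordered by $i\leqslant j$ iff $\mathscr{C}(i,j)\neq\emptyset$. A left (resp. right) $\mathscr{C}$-module is a covariant (resp. contravariant) functor from $\mathscr{C}$ to $\Bbbk$-vector spaces. Let $A=\bigoplus_{i,j\in I}\Bbbk\mathscr{C}(i,j)$ be the (possibly non-unital) category algebra, with multiplication given by composition of morphisms (zero when not composable), and let $e_i\in\mathscr{C}(i,i)$ be the identity of $i$. A left (resp. right) $A$-module $V$ is graded if $V=\bigoplus_{i}e_iV$ (resp. $V=\bigoplus_i Ve_i$). Left (right) $\mathscr{C}$-modules $W$ are identified with graded left (right) $A$-modules via $W\mapsto\bigoplus_i W(i)$; thus $Ae_i$ is the left $\mathscr{C}$-module $j\mapsto\Bbbk\mathscr{C}(i,j)$. A module is finitely generated (resp. finite-dimensional) if it is so as a graded $A$-module. $\mathscr{C}\text{-mod}$ is the category of finitely generated left $\mathscr{C}$-modules, and $\mathscr{C}\text{-fdmod}$ is its full subcategory of finite-dimensional modules. Standing assumptions: $\mathscr{C}$ is inwards finite (for each $j\in I$ there are only finitely many $i\in I$ with $\mathscr{C}(i,j)\neq\emptyset$), hom-finite (each $\mathscr{C}(i,j)$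 is finite), and locally noetherian (every submodule of a finitely generated left $\mathscr{C}$-module is finitely generated). For $V$ in $\mathscr{C}\text{-mod}$, $\operatorname{Hom}_{\mathscr{C}}(V,A)\cong\bigoplus_{i\in I}\operatorname{Hom}_{\mathscr{C}}(V,Ae_i)$ is a finite-dimensional right $\mathscr{C}$-module (via right multiplication on $A$). Let $D=\operatorname{Hom}_{\Bbbk}(-,\Bbbk)$ be the standard duality between finite-dimensional left and finite-dimensional right $\mathscr{C}$-modules. The Nakayama functor is $\nu=D\circ\operatorname{Hom}_{\mathscr{C}}(-,A):\mathscr{C}\text{-mod}\to\mathscr{C}\text{-fdmod}$, and $\operatorname{Ker}(\nu)$ is the full subcategory of $\mathscr{C}\text{-mod}$ on the objects $V$ with $\nu(V)=0$. *)

(* Defs.v *)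
From HB Require Import structures.
From mathcomp Require Import all_boot all_order all_algebra.
From mathcomp Require Import boolp classical_sets functions cardinality.

Set Implicit Arguments.
Unset Strict Implicit.
Unset Printing Implicit Defensive.

Import GRing.Theory.
Local Open Scope ring_scope.
#[local] Obligation Tactic := idtac.

(* A small hom-finite category: hom-finiteness is carried by the type of [mor].
   [mor_comp g f] is g o f. *)
Record homfinite_category := HomFiniteCategory {
  obj :> Type;
  mor : obj -> obj -> finType;
  mor_id : forall i, mor i i;
  mor_comp : forall i j l, mor j l -> mor i j -> mor i l;
  mor_comp_idl : forall i j (f : mor i j), mor_comp (mor_id j) f = f;
  mor_comp_idr : forall i j (f : mor i j), mor_comp f (mor_id i) = f;
  mor_comp_assoc : forall i j l m (h : mor l m) (g : mor j l) (f : mor i j),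
    mor_comp h (mor_comp g f) = mor_comp (mor_comp h g) f
}.
Arguments mor {_}.
Arguments mor_id {_}.
Arguments mor_comp {_ _ _ _}.

Section Categories.
Variable C : homfinite_category.

Definition is_iso (i j : C) (f : mor i j) : Prop :=
  exists g : mor j i, mor_comp g f = mor_id i /\ mor_comp f g = mor_id j.

Definition is_mono (i j : C) (f : mor i j) : Prop :=
  forall (l : C) (g h : mor l i), mor_comp f g = mor_comp f h -> g = h.

Definition EI : Prop := forall (i : C) (f : mor i i), is_iso f.

Definition skeletal : Prop :=
  forall i j : C, (exists f : mor i j, is_iso f) -> i = j.

(* A partial order on the objects when C is skeletal and EI. *)
Definition obj_le (i j : C) : Prop := inhabited (mor i j).

Definition maximal_obj (m : C) : Prop := forall j : C, obj_le m j -> j = m.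

Definition inwards_finite : Prop :=
  forall j : C, finite_set [set i : C | obj_le i j]%classic.

End Categories.

Section Modules.
Variables (k : fieldType) (C : homfinite_category).

Record left_module := LeftModule {
  lm_obj :> C -> lmodType k;
  lm_map : forall i j : C, mor i j -> lm_obj i -> lm_obj j;
  lm_linear : forall i j (f : mor i j), linear (lm_map f);
  lm_id : forall i (x : lm_obj i), lm_map (mor_id i) x = x;
  lm_comp : forall i j l (g : mor j l) (f : mor i j) (x : lm_obj i),
    lm_map (mor_comp g f) x = lm_map g (lm_map f x)
}.

Record right_module := RightModule {
  rm_obj :> C -> lmodType k;
  rm_map : forall i j : C, mor i j -> rm_obj j -> rm_obj i;
  rm_linear : forall i j (f : mor i j), linear (rm_map f);
  rm_id : forall i (x : rm_obj i), rm_map (mor_id i) x = x;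
  rm_comp : forall i j l (g : mor j l) (f : mor i j) (x : rm_obj l),
    rm_map (mor_comp g f) x = rm_map f (rm_map g x)
}.

Arguments lm_map V {i j} f : rename.
Arguments rm_map W {i j} f : rename.
Arguments lm_linear V {i j} f : rename.
Arguments rm_linear W {i j} f : rename.

HB.instance Definition _ (V : left_module) (i j : C) (f : mor i j) :=
  GRing.isLinear.Build k (V i) (V j) *:%R (lm_map V f) (lm_linear V f).
HB.instance Definition _ (W : right_module) (i j : C) (f : mor i j) :=
  GRing.isLinear.Build k (W j) (W i) *:%R (rm_map W f) (rm_linear W f).

Definition module_zero (V : left_module) : Prop :=
  forall (i : C) (x : V i), x = 0.

Section Finiteness.
Variable V : left_module.

(* A family U of predicates is a graded subset of the graded A-module given by
   the direct sum of the V i. *)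
Definition is_graded_subspace (U : forall i, V i -> Prop) : Prop :=
  forall i, U i 0 /\
    forall (a : k) (x y : V i), U i x -> U i y -> U i (a *: x + y).

Definition is_submodule (U : forall i, V i -> Prop) : Prop :=
  is_graded_subspace U /\
  forall (i j : C) (f : mor i j) (x : V i), U i x -> U j (lm_map V f x).

(* Generators are taken homogeneous: the homogeneous components of a finite set
   of generators (resp. of a finite spanning set) of a graded module form again
   such a finite set. *)
Definition contains_all n (b : 'I_n -> {i : C & V i})
    (U : forall i, V i -> Prop) : Prop :=
  forall t, U (tag (b t)) (tagged (b t)).

Definition finitely_generated_submodule (N : forall i, V i -> Prop) : Prop :=
  exists n (b : 'I_n -> {i : C & V i}), contains_all b N /\
    forall U, is_submodule U -> contains_all b U -> forall i x, N i x -> U i x.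

Definition finitely_generated : Prop :=
  finitely_generated_submodule (fun _ _ => True).

Definition finite_dimensional : Prop :=
  exists n (b : 'I_n -> {i : C & V i}),
    forall U, is_graded_subspace U -> contains_all b U -> forall i x, U i x.

End Finiteness.

Definition locally_noetherian : Prop :=
  forall V : left_module, finitely_generated V ->
  forall N : forall i, V i -> Prop, is_submodule N ->
  finitely_generated_submodule N.

(* The component A e_i of the category algebra is the left module sending j to
   k C(i,j), the space of functions mor i j -> k; f : mor j l acts on the basis
   by g |-> mor_comp f g. *)
Section Projective.
Variable i : C.

Definition Ae_obj (j : C) : lmodType k := {ffun mor i j -> k^o}.

Definition Ae_map (j l : C) (f : mor j l) (x : Ae_obj j) : Ae_obj l :=
  [ffun h => \sum_(g : mor i j | mor_comp f g == h) x g].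

Lemma Ae_linear j l (f : mor j l) : linear (Ae_map f).
Proof.
move=> a x y; apply/ffunP => h; rewrite !ffunE scaler_sumr -big_split /=.
by apply: eq_bigr => g _; rewrite !ffunE.
Qed.

Lemma Ae_id j (x : Ae_obj j) : Ae_map (mor_id j) x = x.
Proof.
apply/ffunP => h; rewrite ffunE; under eq_bigl do rewrite mor_comp_idl.
by rewrite big_pred1_eq.
Qed.

Lemma Ae_comp j l m (g : mor l m) (f : mor j l) (x : Ae_obj j) :
  Ae_map (mor_comp g f) x = Ae_map g (Ae_map f x).
Proof.
apply/ffunP => h; rewrite !ffunE.
under [RHS]eq_bigr do rewrite ffunE.
rewrite (exchange_big_dep predT) //= big_mkcond /=; apply: eq_bigr => u _.
rewrite -mor_comp_assoc.
under eq_bigl => v do rewrite andbC eq_sym.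
have [gfh|gfh] := boolP (mor_comp g (mor_comp f u) == h).
  rewrite (big_pred1 (mor_comp f u)) // => v /=.
  by case: eqVneq => //= ->.
by rewrite big_pred0 // => v; case: eqVneq => //= ->; apply/negbTE.
Qed.

Definition Ae : left_module := LeftModule Ae_linear Ae_id Ae_comp.

End Projective.

(* Right multiplication A e_i' -> A e_i by f : mor i i', sending the basis
   element g to mor_comp g f. *)
Definition Ae_rmul (i i' : C) (f : mor i i') (j : C) (x : Ae i' j) : Ae i j :=
  [ffun h => \sum_(g : mor i' j | mor_comp g f == h) x g].

Lemma Ae_rmul_linear i i' (f : mor i i') j : linear (@Ae_rmul i i' f j).
Proof.
move=> a x y; apply/ffunP => h; rewrite !ffunE scaler_sumr -big_split /=.
by apply: eq_bigr => g _; rewrite !ffunE.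
Qed.

Lemma Ae_rmul_id i j (x : Ae i j) : Ae_rmul (mor_id i) x = x.
Proof.
apply/ffunP => h; rewrite ffunE; under eq_bigl do rewrite mor_comp_idr.
by rewrite big_pred1_eq.
Qed.

Lemma Ae_rmul_comp i i' i'' (g : mor i' i'') (f : mor i i') j (x : Ae i'' j) :
  Ae_rmul (mor_comp g f) x = Ae_rmul f (Ae_rmul g x).
Proof.
apply/ffunP => h; rewrite !ffunE.
under [RHS]eq_bigr do rewrite ffunE.
rewrite (exchange_big_dep predT) //= big_mkcond /=; apply: eq_bigr => u _.
rewrite mor_comp_assoc.
under eq_bigl => v do rewrite andbC eq_sym.
have [gfh|gfh] := boolP (mor_comp (mor_comp u g) f == h).
  rewrite (big_pred1 (mor_comp u g)) // => v /=.
  by case: eqVneq => //= ->.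
by rewrite big_pred0 // => v; case: eqVneq => //= ->; apply/negbTE.
Qed.

Lemma Ae_rmulC i i' (f : mor i i') j l (g : mor j l) (x : Ae i' j) :
  Ae_rmul f (lm_map (Ae i') g x) = lm_map (Ae i) g (Ae_rmul f x).
Proof.
apply/ffunP => h; rewrite !ffunE.
under eq_bigr do rewrite ffunE.
under [RHS]eq_bigr do rewrite ffunE.
rewrite (exchange_big_dep predT) //= [RHS](exchange_big_dep predT) //=.
apply: eq_bigr => u _.
under eq_bigl => v do rewrite andbC eq_sym.
under [RHS]eq_bigl => v do rewrite andbC eq_sym.
have [gfh|gfh] := boolP (mor_comp g (mor_comp u f) == h).
  rewrite (big_pred1 (mor_comp g u)); last first.
    by move=> v /=; case: eqVneq => //= ->; rewrite -mor_comp_assoc.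
  by rewrite (big_pred1 (mor_comp u f)) // => v /=; case: eqVneq => //= ->.
rewrite big_pred0; last first.
  by move=> v; case: eqVneq => //= ->; rewrite -mor_comp_assoc; apply/negbTE.
by rewrite big_pred0 // => v; case: eqVneq => //= ->; apply/negbTE.
Qed.

(* Hom_C(V, W) as a vector space. *)
Section Homs.
Variables V W : left_module.

Record module_hom := ModuleHom {
  mh_fun :> forall j : C, V j -> W j;
  mh_linear : forall j, linear (@mh_fun j);
  mh_natural : forall (j l : C) (f : mor j l) (x : V j),
    mh_fun (lm_map V f x) = lm_map W f (mh_fun x)
}.
Arguments mh_fun _ j _ : clear implicits.
Arguments mh_linear _ j : clear implicits.

HB.instance Definition _ (phi : module_hom) (j : C) :=
  GRing.isLinear.Build k (V j) (W j) *:%R (phi j) (mh_linear phi j).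

Lemma module_homP (phi psi : module_hom) :
  (forall j x, phi j x = psi j x) -> phi = psi.
Proof.
case: phi psi => [p lp np] [q lq nq] /= pq.
have e : p = q by apply: functional_extensionality_dep => j; apply: funext => x.
by subst q; congr ModuleHom; apply: Prop_irrelevance.
Qed.

HB.instance Definition _ := gen_eqMixin module_hom.
HB.instance Definition _ := gen_choiceMixin module_hom.

Program Definition mh_zero : module_hom :=
  @ModuleHom (fun j _ => 0) _ _.
Next Obligation. by move=> j a x y /=; rewrite scaler0 addr0. Qed.
Next Obligation. by move=> j l f x /=; rewrite linear0. Qed.

Program Definition mh_add (phi psi : module_hom) : module_hom :=
  @ModuleHom (fun j x => phi j x + psi j x) _ _.
Next Obligation.
by move=> phi psi j a x y /=; rewrite !linearP scalerDr addrACA.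
Qed.
Next Obligation. by move=> phi psi j l f x /=; rewrite !mh_natural linearD. Qed.

Program Definition mh_opp (phi : module_hom) : module_hom :=
  @ModuleHom (fun j x => - phi j x) _ _.
Next Obligation. by move=> phi j a x y /=; rewrite linearP opprD scalerN. Qed.
Next Obligation. by move=> phi j l f x /=; rewrite mh_natural linearN. Qed.

Program Definition mh_scale (a : k) (phi : module_hom) : module_hom :=
  @ModuleHom (fun j x => a *: phi j x) _ _.
Next Obligation.
by move=> a phi j b x y /=; rewrite linearP scalerDr !scalerA mulrC.
Qed.
Next Obligation. by move=> a phi j l f x /=; rewrite mh_natural linearZ. Qed.

Fact mh_addA : associative mh_add.
Proof. by move=> p q r; apply: module_homP => j x /=; rewrite addrA. Qed.
Fact mh_addC : commutative mh_add.
Proof. by move=> p q; apply: module_homP => j x /=; rewrite addrC. Qed.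
Fact mh_add0 : left_id mh_zero mh_add.
Proof. by move=> p; apply: module_homP => j x /=; rewrite add0r. Qed.
Fact mh_addN : left_inverse mh_zero mh_opp mh_add.
Proof. by move=> p; apply: module_homP => j x /=; rewrite addNr. Qed.

HB.instance Definition _ :=
  GRing.isZmodule.Build module_hom mh_addA mh_addC mh_add0 mh_addN.

Fact mh_scaleA a b p : mh_scale a (mh_scale b p) = mh_scale (a * b) p.
Proof. by apply: module_homP => j x /=; rewrite scalerA. Qed.
Fact mh_scale1 : left_id 1 mh_scale.
Proof. by move=> p; apply: module_homP => j x /=; rewrite scale1r. Qed.
Fact mh_scaleDr : right_distributive mh_scale +%R.
Proof. by move=> a p q; apply: module_homP => j x /=; rewrite scalerDr. Qed.
Fact mh_scaleDl p : {morph mh_scale^~ p : a b / a + b}.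
Proof. by move=> a b; apply: module_homP => j x /=; rewrite scalerDl. Qed.

HB.instance Definition _ := GRing.Zmodule_isLmodule.Build k module_hom
  mh_scaleA mh_scale1 mh_scaleDr mh_scaleDl.

End Homs.

(* Hom_C(V, A) as a right module: its component at i is
   Hom_C(V, A) e_i = Hom_C(V, A e_i), and C acts by right multiplication
   on A. *)
Section HomA.
Variable V : left_module.

Definition HomA_obj (i : C) : lmodType k := module_hom V (Ae i).

Program Definition HomA_map (i i' : C) (f : mor i i') (phi : HomA_obj i') :
  HomA_obj i := @ModuleHom V (Ae i) (fun j x => Ae_rmul f (phi j x)) _ _.
Next Obligation.
by move=> i i' f phi j a x y /=; rewrite linearP Ae_rmul_linear.
Qed.
Next Obligation.
by move=> i i' f phi j l g x /=; rewrite mh_natural Ae_rmulC.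
Qed.

Lemma HomA_linear i i' (f : mor i i') : linear (HomA_map f).
Proof. by move=> a p q; apply: module_homP => j x; apply: Ae_rmul_linear. Qed.

Lemma HomA_id i (phi : HomA_obj i) : HomA_map (mor_id i) phi = phi.
Proof. by apply: module_homP => j x; apply: Ae_rmul_id. Qed.

Lemma HomA_comp i i' i'' (g : mor i' i'') (f : mor i i') (phi : HomA_obj i'') :
  HomA_map (mor_comp g f) phi = HomA_map f (HomA_map g phi).
Proof. by apply: module_homP => j x; apply: Ae_rmul_comp. Qed.

Definition HomA : right_module := RightModule HomA_linear HomA_id HomA_comp.

End HomA.

Section Dual.
Variable E : lmodType k.

Record dual := Dual {
  dual_fun :> E -> k;
  dual_linear : scalar dual_fun
}.

HB.instance Definition _ (u : dual) :=
  GRing.isLinear.Build k E k *%R u (dual_linear u).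

Lemma dualP (u v : dual) : (forall x, u x = v x) -> u = v.
Proof.
case: u v => [p lp] [q lq] /= pq.
have e : p = q by apply: funext.
by subst q; congr Dual; apply: Prop_irrelevance.
Qed.

HB.instance Definition _ := gen_eqMixin dual.
HB.instance Definition _ := gen_choiceMixin dual.

Program Definition dual_zero : dual := @Dual (fun _ => 0) _.
Next Obligation. by move=> a x y /=; rewrite mulr0 addr0. Qed.

Program Definition dual_add (u v : dual) : dual :=
  @Dual (fun x => u x + v x) _.
Next Obligation.
by move=> u v a x y /=; rewrite !dual_linear mulrDr addrACA.
Qed.

Program Definition dual_opp (u : dual) : dual := @Dual (fun x => - u x) _.
Next Obligation. by move=> u a x y /=; rewrite dual_linear opprD mulrN. Qed.

Program Definition dual_scale (a : k) (u : dual) : dual :=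
  @Dual (fun x => a * u x) _.
Next Obligation.
by move=> a u b x y /=; rewrite dual_linear mulrDr mulrCA.
Qed.

Fact dual_addA : associative dual_add.
Proof. by move=> p q r; apply: dualP => x /=; rewrite addrA. Qed.
Fact dual_addC : commutative dual_add.
Proof. by move=> p q; apply: dualP => x /=; rewrite addrC. Qed.
Fact dual_add0 : left_id dual_zero dual_add.
Proof. by move=> p; apply: dualP => x /=; rewrite add0r. Qed.
Fact dual_addN : left_inverse dual_zero dual_opp dual_add.
Proof. by move=> p; apply: dualP => x /=; rewrite addNr. Qed.

HB.instance Definition _ :=
  GRing.isZmodule.Build dual dual_addA dual_addC dual_add0 dual_addN.

Fact dual_scaleA a b p : dual_scale a (dual_scale b p) = dual_scale (a * b) p.
Proof. by apply: dualP => x /=; rewrite mulrA. Qed.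
Fact dual_scale1 : left_id 1 dual_scale.
Proof. by move=> p; apply: dualP => x /=; rewrite mul1r. Qed.
Fact dual_scaleDr : right_distributive dual_scale +%R.
Proof. by move=> a p q; apply: dualP => x /=; rewrite mulrDr. Qed.
Fact dual_scaleDl p : {morph dual_scale^~ p : a b / a + b}.
Proof. by move=> a b; apply: dualP => x /=; rewrite mulrDl. Qed.

HB.instance Definition _ := GRing.Zmodule_isLmodule.Build k dual
  dual_scaleA dual_scale1 dual_scaleDr dual_scaleDl.

End Dual.

(* D = Hom_k(-, k), from right modules to left modules. *)
Section Duality.
Variable W : right_module.

Definition D_obj (i : C) : lmodType k := dual (W i).

Program Definition D_map (i j : C) (f : mor i j) (u : D_obj i) : D_obj j :=
  @Dual (W j) (fun x => u (rm_map W f x)) _.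
Next Obligation.
by move=> i j f u a x y /=; rewrite linearP dual_linear.
Qed.

Lemma D_linear i j (f : mor i j) : linear (D_map f).
Proof. by move=> a u v; apply: dualP. Qed.

Lemma D_id i (u : D_obj i) : D_map (mor_id i) u = u.
Proof. by apply: dualP => x /=; rewrite rm_id. Qed.

Lemma D_comp i j l (g : mor j l) (f : mor i j) (u : D_obj i) :
  D_map (mor_comp g f) u = D_map g (D_map f u).
Proof. by apply: dualP => x /=; rewrite rm_comp. Qed.

Definition D : left_module := LeftModule D_linear D_id D_comp.

End Duality.

(* The Nakayama functor on objects, which is all that its kernel involves. *)
Definition nakayama (V : left_module) : left_module := D (HomA V).

(* C-fdmod and Ker(nu) are full subcategories of C-mod, hence given by their
   classes of objects. *)
Definition in_fdmod (V : left_module) : Prop :=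
  finitely_generated V /\ finite_dimensional V.

Definition in_Ker_nakayama (V : left_module) : Prop :=
  finitely_generated V /\ module_zero (nakayama V).

End Modules.

Arguments lm_map {k C} V {i j} f : rename.
Arguments rm_map {k C} W {i j} f : rename.
Arguments mh_fun {k C V W} _ j _.

(* Main.v *)
(** A finite-dimensional module [V] is supported on finitely many objects.  As
    no object is maximal, every [j] has a morphism [f : j -> l] with [V l = 0].
    Since [f] is a monomorphism, it acts injectively on each [A e_i], whereas
    naturality makes it kill the image of [V j] under any map [V -> A e_i].
    Hence [Hom_C(V, A) = 0]. *)
Require Import Defs.
From mathcomp Require Import all_boot all_algebra.
From mathcomp Require Import boolp.

Set Implicit Arguments.
Unset Strict Implicit.
Unset Printing Implicit Defensive.

Import GRing.Theory.
Local Open Scope ring_scope.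

Lemma obj_le_refl (C : homfinite_category) (i : C) : obj_le i i.
Proof. exact: inhabits (mor_id i). Qed.

Lemma obj_le_trans (C : homfinite_category) (i j l : C) :
  obj_le i j -> obj_le j l -> obj_le i l.
Proof. by move=> [f] [g]; exact: inhabits (mor_comp g f). Qed.

(** By EI both [g f] and [f g] are invertible, so [f] has a left inverse [u g] and a right inverse
    [g w]; these coincide. *)
Lemma obj_le_anti (C : homfinite_category) (HEI : EI C) (Hskel : skeletal C)
    (i j : C) : obj_le i j -> obj_le j i -> i = j.
Proof.
move=> [f] [g]; apply: Hskel; exists f.
have [u [ugf _]] := HEI i (mor_comp g f).
have [w [_ fgw]] := HEI j (mor_comp f g).
have ugE : mor_comp u g = mor_comp g w.
  rewrite -[LHS]mor_comp_idr -fgw -(mor_comp_assoc f) mor_comp_assoc.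
  by rewrite -(mor_comp_assoc u) ugf mor_comp_idl.
exists (mor_comp u g); split; first by rewrite -mor_comp_assoc.
by rewrite ugE mor_comp_assoc.
Qed.

(** Climb strictly from [j] until the values of [s] are avoided. This stops because each step away
    from a value of [s] shrinks the finite set of indices [t] with [j] below [s t]. *)
Lemma exists_above_notin (C : homfinite_category) (HEI : EI C)
    (Hskel : skeletal C) (Hmax : ~ exists m : C, maximal_obj m)
    n (s : 'I_n -> C) (j : C) : exists2 l, obj_le j l & forall t, s t <> l.
Proof.
pose above i := [set t | `[< obj_le i (s t) >]].
have [m] := ubnP #|above j|; elim: m j => // m IHm j le_m.
have [[t0 st0]|js] := pselect (exists t, s t = j); last first.
  by exists j => [|t stj]; [exact: obj_le_refl | apply: js; exists t].
have [j' jj' neq] : exists2 j', obj_le j j' & j' <> j.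
  apply: contrapT => no; apply: Hmax; exists j => j' jj'.
  by apply: contrapT => neq; apply: no; exists j'.
have [|l j'l ls] := IHm j'; last by exists l => //; exact: obj_le_trans j'l.
rewrite -ltnS; apply: leq_ltn_trans le_m; apply: proper_card; apply/properP; split.
  apply/subsetP => t; rewrite !inE => /asboolP j't.
  by apply/asboolP; exact: obj_le_trans j't.
(* The index [t0] is lost: [j'] below [s t0 = j] would force [j' = j] by antisymmetry. *)
exists t0; rewrite inE st0; first by apply/asboolP; exact: obj_le_refl.
by apply/asboolP => j'j; apply: neq; exact: obj_le_anti.
Qed.

(** For [f] mono, the sum giving the coefficient of the image of [x] at [f g] has the single term
    [x g]. *)
Lemma Ae_map_inj (k : fieldType) (C : homfinite_category) (i j l : C)
    (f : mor j l) : is_mono f -> injective (lm_map (Ae k i) f).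
Proof.
move=> f_mono x y /ffunP xy; apply/ffunP => g.
have := xy (mor_comp f g); rewrite !ffunE.
by rewrite !(big_pred1 g) // => h; apply/eqP/eqP => [/f_mono|->].
Qed.

Lemma finite_dimensional_support (k : fieldType) (C : homfinite_category)
    (V : left_module k C) : finite_dimensional V ->
  exists n (s : 'I_n -> C),
    forall i, (forall t, s t <> i) -> forall x : V i, x = 0.
Proof.
move=> [n [b bV]]; exists n, (fun t => tag (b t)) => i notin x.
(* [U] is all of [V l] at the degrees [l] of the spanning vectors and zero elsewhere; it contains
   those vectors, so it is all of [V]. *)
pose U l (y : V l) := (exists t, tag (b t) = l) \/ y = 0.
have [||[t bt]|//] := bV U _ _ i x; last by have := notin t bt.
- move=> l; split=> [|a y z]; first by right.
  move=> [?|->]; first by left.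
  move=> [?|->]; first by left.
  by right; rewrite scaler0 addr0.
- by move=> t; left; exists t.
Qed.

Theorem corollary3p9 (k : fieldType) (C : homfinite_category)
    (HEI : EI C) (Hskel : skeletal C) (Hin : inwards_finite C)
    (Hnoeth : locally_noetherian k C)
    (Hmax : ~ exists m : C, maximal_obj m)
    (Hmono : forall (i j : C) (f : mor i j), is_mono f) :
  forall V : left_module k C, in_fdmod V -> in_Ker_nakayama V.
Proof.
move=> V [V_fg /finite_dimensional_support [n [s sV]]]; split=> // i u.
have hom0 (phi : HomA V i) : phi = 0.
  apply: module_homP => j x.
  have [l [f] ls] := exists_above_notin HEI Hskel Hmax s j.
  apply: (Ae_map_inj (Hmono _ _ f)).
  by rewrite -mh_natural (sV l ls (lm_map V f x)) !linear0.
by apply: dualP => phi; rewrite (hom0 phi) linear0.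
Qed.
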